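(* Let $A:\mathcal{H}\to\mathcal{H}$ be an accretive bounded linear operator on a (real or complex) Hilbert space $\mathcal{H}$, and let $u\in\mathcal{H}$. If, for some $0<p\le 1$, we have $P^\delta(u)=\mathcal{O}(\delta^{p/(p+1)})$ as $\delta\to 0$, then $\|u_\gamma-u\|=\mathcal{O}(\gamma^p)$ as $\gamma\to 0$.
   Context: A bounded linear operator $A:\mathcal{H}\to\mathcal{H}$ on a real or complex Hilbert space is called accretive if $\mathrm{Re}\,\langle Au,u\rangle\ge 0$ for all $u\in\mathcal{H}$; then for every $\gamma>0$ the operator $A+\gamma I$ has a bounded inverse with $\|(A+\gamma I)^{-1}\|\le 1/\gamma$. For $u\in\mathcal{H}$ and $\gamma>0$ put $u_\gamma:=(A+\gamma I)^{-1}Au$, so that $u_\gamma-u=-\gamma(A+\gamma I)^{-1}u$. For $\delta>0$ the maximal best possible error of Lavrentiev regularization is $$P^\delta(u):=\sup_{f^\delta\in\mathcal{H}:\ \|Au-f^\delta\|\le\delta}\ \inf_{\gamma>0}\|(A+\gamma I)^{-1}f^\delta-u\|.$$ Limits $\gamma\to0$ and $\delta\to 0$ are through positive values. *)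

(* Defs.v *)
From mathcomp Require Export all_boot all_order all_algebra.
From mathcomp Require Export all_classical all_reals all_analysis.
From mathcomp Require Export complex.
Export Order.TTheory GRing.Theory Num.Theory.
Export numFieldNormedType.Exports.

Set Implicit Arguments.
Unset Strict Implicit.
Unset Printing Implicit Defensive.

Local Open Scope classical_set_scope.
Local Open Scope ring_scope.

(* Real and complex scalars are treated uniformly: a scalar field is R or R[i],
   with its conjugation, its real part and the embedding of R. *)
Variant scalar_kind := RealScalars | ComplexScalars.

Definition scalar (R : realType) (k : scalar_kind) : numFieldType :=
  match k with RealScalars => R | ComplexScalars => R[i] end.

Definition scalar_conj (R : realType) (k : scalar_kind) :
    scalar R k -> scalar R k :=
  match k with RealScalars => idfun | ComplexScalars => @conjc R end.

Definition scalar_re (R : realType) (k : scalar_kind) : scalar R k -> R :=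
  match k with RealScalars => idfun | ComplexScalars => @complex.Re R end.

Definition scalar_of_real (R : realType) (k : scalar_kind) : R -> scalar R k :=
  match k with RealScalars => idfun | ComplexScalars => fun x => (x%:C)%C end.
Arguments scalar_of_real {R} k.

(* f = O(g) along F for an extended-real-valued f; the library's bigO is
   restricted to functions with values in a normed module. *)
Definition ereal_bigO (R : realType) (T : Type) (F : set_system T)
    (f : T -> \bar R) (g : T -> R) : Prop :=
  exists2 C : R, 0 < C & \forall x \near F, (`|f x| <= (C * `|g x|)%:E)%E.

Section Lavrentiev.
Variables (R : realType) (k : scalar_kind).
Local Notation K := (scalar R k).
Variable V : completeNormedModType K.

(* With completeness of V, this makes (V, dot) a Hilbert space over K. *)
Definition norm_from_dot (dot : {dot V for @scalar_conj R k}) : Prop :=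
  forall v : V, `|v| ^+ 2 = dot v v.

(* The norm of V takes its values in K; hnorm is the same number as a real. *)
Definition hnorm (v : V) : R := scalar_re `|v|.

Definition bounded_operator (A : {linear V -> V}) : Prop :=
  exists M : R, forall v : V, hnorm (A v) <= M * hnorm v.

Definition accretive (dot : {dot V for @scalar_conj R k})
    (A : {linear V -> V}) : Prop :=
  forall v : V, 0 <= scalar_re (dot (A v) v).

Definition shift (A : {linear V -> V}) (gamma : R) (v : V) : V :=
  A v + scalar_of_real k gamma *: v.

(* (A + gamma I)^-1: for A bounded accretive and gamma > 0, A + gamma I is a
   bijection of V, so the default value 0 of the inverse is never used. *)
Definition shift_inv (A : {linear V -> V}) (gamma : R) : V -> V :=
  ('pinv_(fun=> 0) setT (shift A gamma))%FORM.

Definition u_reg (A : {linear V -> V}) (u : V) (gamma : R) : V :=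
  shift_inv A gamma (A u).

Definition max_best_error (A : {linear V -> V}) (u : V) (delta : R) : \bar R :=
  ereal_sup [set ereal_inf [set (hnorm (shift_inv A gamma f - u))%:E
                           | gamma in [set gamma : R | 0 < gamma]]
            | f in [set f : V | hnorm (A u - f) <= delta]].

End Lavrentiev.

(* Main.v *)
(* With [e(g)] the regularization error at [g], it suffices to bound [e(g)] by a
   multiple of [P^delta] at [delta = 4 g e(g)]: the hypothesis then reads
   [e <= C (g e)^(p/(p+1))], which can be solved for [e].
   If [A] is bounded below, [e(g) = O(g)] directly.  Otherwise take as noise a
   vector [d] of norm [delta] with [A d] nearly [0] and [Re <d, u> <= 0].  For
   parameters [b <= g] the noise contribution to the reconstruction is at least
   [2 e(g)] while the regularization error is at most [e(g)].  For [b >= g] the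
   regularization error is at least [e(g)], and it cannot be cancelled by the
   noise, because accretivity makes [d] an approximate kernel vector of the
   adjoint too, so that the real inner product of the two has the right sign up
   to a small error. *)
Require Import Defs.
From mathcomp Require Import ring lra.

Set Implicit Arguments.
Unset Strict Implicit.
Unset Printing Implicit Defensive.

Local Open Scope classical_set_scope.
Local Open Scope ring_scope.

(** * Real part and real embedding, for both scalar fields at once *)

Section Scalars.
Variables (R : realType) (k : scalar_kind).
Local Notation K := (scalar R k).
Local Notation re := (@scalar_re R k).
Local Notation conj := (@scalar_conj R k).
Local Notation sr := (@scalar_of_real R k).

Lemma scalar_reD (z w : K) : re (z + w) = re z + re w.
Proof. by case: k z w => //= -[a b] [c d]. Qed.

Lemma scalar_reN (z : K) : re (- z) = - re z.
Proof. by case: k z => //= -[a b]. Qed.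

Lemma scalar_re_realM (c : R) (z : K) : re (sr c * z) = c * re z.
Proof. by case: k z => //= -[a b] /=; rewrite mul0r subr0. Qed.

Lemma scalar_of_realK : cancel sr re.
Proof. by case: k. Qed.

Lemma ge0_scalar_reK (z : K) : 0 <= z -> sr (re z) = z.
Proof. by case: k z => //= -[a b]; rewrite lecE /= => /andP[/eqP -> _]. Qed.

Lemma scalar_re_conj (z : K) : re (conj z) = re z.
Proof. by case: k z => //= -[a b]. Qed.

Lemma scalar_of_realD (a b : R) : sr (a + b) = sr a + sr b.
Proof. by case: k => //=; rewrite rmorphD. Qed.

Lemma scalar_of_realM (a b : R) : sr (a * b) = sr a * sr b.
Proof. by case: k => //=; rewrite rmorphM. Qed.

Lemma scalar_of_real1 : sr 1 = 1.
Proof. by case: k. Qed.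

Lemma scalar_of_real0 : sr 0 = 0.
Proof. by case: k. Qed.

Lemma ler_scalar_of_real (a b : R) : (sr a <= sr b) = (a <= b).
Proof. by case: k => //=; rewrite lecR. Qed.

Lemma ltr_scalar_of_real (a b : R) : (sr a < sr b) = (a < b).
Proof. by case: k => //=; rewrite ltcR. Qed.

Lemma scalar_of_real_norm (a : R) : `|sr a| = sr `|a|.
Proof. by case: k => //=; rewrite normc_def /= expr0n addr0 sqrtr_sqr. Qed.

End Scalars.

(** * The norm as a real number *)

Section HilbertNorm.
Variables (R : realType) (k : scalar_kind).
Local Notation K := (scalar R k).
Variable V : completeNormedModType K.
Local Notation sr := (@scalar_of_real R k).
Implicit Types (v w x y z : V) (c : R).

Lemma hnormE v : `|v| = sr (hnorm v).
Proof. by rewrite /hnorm ge0_scalar_reK. Qed.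

Lemma hnorm_ge0 v : 0 <= hnorm v.
Proof. by rewrite -(ler_scalar_of_real k) scalar_of_real0 -hnormE. Qed.

Lemma hnormD v w : hnorm (v + w) <= hnorm v + hnorm w.
Proof.
by rewrite -(ler_scalar_of_real k) scalar_of_realD -!hnormE; exact: ler_normD.
Qed.

Lemma hnormN v : hnorm (- v) = hnorm v.
Proof. by rewrite /hnorm normrN. Qed.

Lemma hnormB v w : hnorm (v - w) <= hnorm v + hnorm w.
Proof. by rewrite (le_trans (hnormD _ _))// hnormN. Qed.

Lemma ler_hnormB v w : hnorm v - hnorm w <= hnorm (v - w).
Proof. by rewrite lerBlDr (le_trans _ (hnormD _ _))// subrK. Qed.

Lemma hnormZ c v : hnorm (sr c *: v) = `|c| * hnorm v.
Proof.
rewrite -[RHS](scalar_of_realK k) scalar_of_realM -hnormE /hnorm.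
by rewrite normrZ scalar_of_real_norm.
Qed.

Lemma ge0_hnormZ c v : 0 <= c -> hnorm (sr c *: v) = c * hnorm v.
Proof. by move=> c0; rewrite hnormZ ger0_norm. Qed.

Lemma hnorm0 : hnorm (0 : V) = 0.
Proof. by rewrite /hnorm normr0 -(scalar_of_real0 R k) scalar_of_realK. Qed.

Lemma hnorm0_eq0 v : hnorm v = 0 -> v = 0.
Proof. by move=> v0; apply/normr0_eq0; rewrite hnormE v0 scalar_of_real0. Qed.

Lemma hnorm_gt0 v : v != 0 -> 0 < hnorm v.
Proof.
by move=> v0; rewrite lt_neqAle hnorm_ge0 andbT eq_sym (contra_neq (@hnorm0_eq0 v)).
Qed.

End HilbertNorm.

(** * The real inner product and Cauchy-Schwarz *)

Section RealDot.
Variables (R : realType) (k : scalar_kind).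
Local Notation K := (scalar R k).
Variables (V : completeNormedModType K) (dot : {dot V for @scalar_conj R k}).
Hypothesis hV : norm_from_dot dot.
Local Notation sr := (@scalar_of_real R k).
Implicit Types (v w x y z : V) (c : R).

Definition rdot v w : R := scalar_re (dot v w).

Lemma rdotC v w : rdot v w = rdot w v.
Proof.
by rewrite /rdot (@hermitian_subproof _ _ _ _ dot v w) expr0 mul1r scalar_re_conj.
Qed.

Lemma rdotDl x v w : rdot (v + w) x = rdot v x + rdot w x.
Proof. by rewrite /rdot linearDl scalar_reD. Qed.

Lemma rdotNl v w : rdot (- v) w = - rdot v w.
Proof. by rewrite /rdot linearNl scalar_reN. Qed.

Lemma rdotZl c v w : rdot (sr c *: v) w = c * rdot v w.
Proof. by rewrite /rdot linearZl_LR scalar_re_realM. Qed.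

Lemma rdotDr x v w : rdot x (v + w) = rdot x v + rdot x w.
Proof. by rewrite rdotC rdotDl !(rdotC x). Qed.

Lemma rdotNr v w : rdot v (- w) = - rdot v w.
Proof. by rewrite rdotC rdotNl rdotC. Qed.

Lemma rdotZr c v w : rdot v (sr c *: w) = c * rdot v w.
Proof. by rewrite rdotC rdotZl rdotC. Qed.

Definition rdotE := (rdotDl, rdotDr, rdotNl, rdotNr, rdotZl, rdotZr).

Lemma hnorm_sqr v : hnorm v ^+ 2 = rdot v v.
Proof.
by rewrite /rdot -hV hnormE !expr2 -scalar_of_realM scalar_of_realK.
Qed.

(** Square the triangle inequality, which the given norm already satisfies, and compare the cross
    terms. *)
Lemma rdot_le v w : rdot v w <= hnorm v * hnorm w.
Proof.
have : hnorm (v + w) ^+ 2 <= (hnorm v + hnorm w) ^+ 2.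
  by rewrite ler_pXn2r ?nnegrE ?addr_ge0 ?hnorm_ge0 ?hnormD.
by rewrite sqrrD !hnorm_sqr !rdotE (rdotC w v) => h; lra.
Qed.

End RealDot.
Arguments rdot_le {R k V dot}.

(** * Dependence on the parameter of solutions of the shifted equation *)

Section Shift.
Variables (R : realType) (k : scalar_kind).
Local Notation K := (scalar R k).
Variables (V : completeNormedModType K) (dot : {dot V for @scalar_conj R k}).
Hypothesis hV : norm_from_dot dot.
Variable A : {linear V -> V}.
Hypothesis accA : accretive dot A.
Local Notation sr := (@scalar_of_real R k).
Implicit Types (u v w x y z : V) (b c g : R).

Lemma shiftD g v w : shift A g (v + w) = shift A g v + shift A g w.
Proof. by rewrite /shift linearD scalerDr addrACA. Qed.

Lemma shiftN g v : shift A g (- v) = - shift A g v.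
Proof. by rewrite /shift linearN scalerN -opprD. Qed.

Lemma shiftB g v w : shift A g (v - w) = shift A g v - shift A g w.
Proof. by rewrite shiftD shiftN. Qed.

Lemma shiftZ g (c : K) v : shift A g (c *: v) = c *: shift A g v.
Proof. by rewrite /shift linearZ_LR scalerDr !scalerA mulrC. Qed.

(** Accretivity gives [g |v|^2 <= Re <(A + g) v, v>], and Cauchy-Schwarz concludes. For [g > 0] this
    is the resolvent bound [1/g]. *)
Lemma shift_ge g v : g * hnorm v <= hnorm (shift A g v).
Proof.
have [->|v0] := eqVneq v 0; first by rewrite hnorm0 mulr0 hnorm_ge0.
rewrite -(ler_pM2r (hnorm_gt0 v0)) -mulrA -expr2.
apply: le_trans (rdot_le hV _ _); rewrite /shift !rdotE (hnorm_sqr hV).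
by rewrite lerDr accA.
Qed.

Lemma shift_inj g : 0 < g -> injective (shift A g).
Proof.
move=> g0 v w vw; apply/eqP; rewrite -subr_eq0; apply/eqP/hnorm0_eq0.
have := shift_ge g (v - w); rewrite shiftB vw subrr hnorm0 => h.
by apply: le_anti; rewrite hnorm_ge0 andbT -(pmulr_rle0 _ g0).
Qed.

(** Here [A (z - w) = b w - g z]; test accretivity on [z - w] and bound both cross terms by
    Cauchy-Schwarz. *)
Lemma shift_eq_hnorm g b z w : 0 <= g -> 0 <= b -> shift A g z = shift A b w ->
  0 <= (b * hnorm w - g * hnorm z) * (hnorm z - hnorm w).
Proof.
move=> g0 b0 zw.
have := accA (z - w); rewrite -/(rdot dot _ _) linearB /=.
have -> : A z - A w = sr b *: w - sr g *: z.
  apply/eqP; rewrite subr_eq addrAC (addrC _ (A w)).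
  by rewrite -/(shift A b w) -zw addrK.
rewrite !rdotE -!(hnorm_sqr hV) (rdotC dot z w) => h.
have cs := rdot_le hV w z.
have := ler_wpM2l g0 cs; have := ler_wpM2l b0 cs.
by move: h; lra.
Qed.

(** If either conclusion failed, the factors in [shift_eq_hnorm] would have strictly opposite
    signs. *)
Lemma shift_eq_le g b z w : 0 < g -> g <= b -> shift A g z = shift A b w ->
  hnorm w <= hnorm z /\ g * hnorm z <= b * hnorm w.
Proof.
move=> g0 gb /(shift_eq_hnorm (ltW g0) (le_trans (ltW g0) gb)).
have := hnorm_ge0 w; have := hnorm_ge0 z.
move: (hnorm z) (hnorm w) => Z W Z0 W0 h.
have gbW : g * W <= b * W by rewrite ler_wpM2r.
split; rewrite leNgt; apply/negP => lt; move: h; apply/negP; rewrite -ltNge.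
  rewrite nmulr_llt0 ?subr_lt0// subr_gt0 (lt_le_trans _ gbW)//.
  by rewrite ltr_pM2l.
by rewrite nmulr_rlt0 ?subr_lt0// subr_gt0 -(ltr_pM2l g0) (le_lt_trans gbW).
Qed.

(** The solution of [(A + g) z = g u] is [u - u_g], so the noise-free error is nondecreasing in the
    parameter: rescale to [z / g], [w / b] and use [shift_eq_le]. *)
Lemma shift_scaled_le u g b z w : 0 < g -> g <= b ->
  shift A g z = sr g *: u -> shift A b w = sr b *: u -> hnorm z <= hnorm w.
Proof.
move=> g0 gb zu wu; have b0 := lt_le_trans g0 gb.
have srK c x : 0 < c -> sr c^-1 *: (sr c *: x) = x.
  move=> c0; rewrite scalerA -scalar_of_realM mulVf ?gt_eqF//.
  by rewrite scalar_of_real1 scale1r.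
have zw : shift A g (sr g^-1 *: z) = shift A b (sr b^-1 *: w).
  by rewrite !shiftZ zu wu !srK.
have [_] := shift_eq_le g0 gb zw.
by rewrite !hnormZ !gtr0_norm ?invr_gt0// !mulVKf// gt_eqF.
Qed.

End Shift.

(** * Completeness in real terms and the contraction principle *)

Section Completeness.
Variables (R : realType) (k : scalar_kind).
Variable V : completeNormedModType (scalar R k).

(** Completeness of [V] uses radii in the scalar field; a positive scalar is the image of a positive
    real, even over the complex numbers. *)
Lemma hnorm_complete (s : nat -> V) :
  (forall e : R, 0 < e -> exists N, forall n m,
     (N <= n)%N -> (N <= m)%N -> hnorm (s n - s m) < e) ->
  exists l : V, forall e : R, 0 < e -> exists N, forall n,
     (N <= n)%N -> hnorm (l - s n) < e.
Proof.
have reK (e : scalar R k) : 0 < e -> exists2 e' : R, 0 < e' & e = scalar_of_real k e'.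
  move=> e0; exists (scalar_re e); last by rewrite ge0_scalar_reK// ltW.
  by rewrite -(ltr_scalar_of_real k) scalar_of_real0 ge0_scalar_reK// ltW.
move=> cs; have : cvgn s.
  apply: cauchy_cvg; apply/cauchy_ballP => e /reK[e' /cs[N sN] ->].
  pose S := [set s n | n in [set n | (N <= n)%N]].
  exists (S, S) => /=; first by split; exists N => // n Nn; exists n.
  move=> [_ _] /= [[n nN <-] [m mN <-]]; rewrite -ball_normE /= hnormE ltr_scalar_of_real.
  exact: sN.
move=> /cvgrPdist_lt sl; exists (limn s) => e e0.
have se0 : 0 < scalar_of_real k e by rewrite -(scalar_of_real0 R k) ltr_scalar_of_real.
have [N _ sN] := sl _ se0; exists N => n /sN /=.
by rewrite hnormE ltr_scalar_of_real.
Qed.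

(* Cauchyness of the iterates without summing a geometric series:
   (1 - q) |x - y| <= |x - T x| + |y - T y|. *)
Lemma hnorm_contraction_fixpoint (T : V -> V) (q : R) : 0 <= q -> q < 1 ->
  (forall v w, hnorm (T v - T w) <= q * hnorm (v - w)) -> exists x, T x = x.
Proof.
move=> q0 q1 Tq; have q1' : 0 < 1 - q by rewrite subr_gt0.
pose y n := iter n T 0; pose D := hnorm (y 0%N - y 1%N).
have D0 : 0 <= D by exact: hnorm_ge0.
have yS n : hnorm (y n - T (y n)) <= q ^+ n * D.
  elim: n => [|n IHn]; first by rewrite expr0 mul1r.
  by rewrite exprS -mulrA (le_trans (Tq _ _))// ler_wpM2l.
have dist x z : (1 - q) * hnorm (x - z) <= hnorm (x - T x) + hnorm (z - T z).
  have := hnormD (x - T x) ((T x - T z) - (z - T z)).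
  have := hnormB (T x - T z) (z - T z); have := Tq x z.
  have -> : (x - T x) + ((T x - T z) - (z - T z)) = x - z.
    by rewrite opprB !subrKA.
  by lra.
have small (e : R) : 0 < e -> exists N, forall n, (N <= n)%N -> q ^+ n * D < e.
  move=> e0; have q1n : `|q| < 1 by rewrite ger0_norm.
  have eD : 0 < e / (D + 1) by rewrite divr_gt0// ltr_wpDl.
  have [N _ qN] := proj1 (cvgrPdist_lt _ _) (cvg_expr q1n) _ eD.
  exists N => n /qN /=; rewrite sub0r normrN ger0_norm ?exprn_ge0// => qn.
  have D1 : 0 < D + 1 by rewrite ltr_wpDl.
  move: qn; rewrite ltr_pdivlMr//; apply: le_lt_trans.
  by rewrite ler_wpM2l ?exprn_ge0// lerDl.
have [|l yl] := @hnorm_complete y.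
  move=> e e0; have [|N qN] := small ((1 - q) * e / 2).
    by rewrite divr_gt0// mulr_gt0.
  exists N => n m /qN yn /qN ym; rewrite -(ltr_pM2l q1').
  have := dist (y n) (y m); have := yS n; have := yS m; by lra.
exists l; apply/eqP; rewrite eq_sym -subr_eq0; apply/eqP/hnorm0_eq0.
apply/eqP; rewrite eq_le hnorm_ge0 andbT; apply/ler_addgt0Pr => e e0.
have [|N qN] := small (e / 3); first by lra.
have [|N' lN'] := yl (e / 3); first by lra.
have := qN (maxn N N') (leq_maxl _ _); have := lN' (maxn N N') (leq_maxr _ _).
move: (maxn N N') => n ln qn.
have -> : l - T l = (l - y n) + ((y n - T (y n)) - (T l - T (y n))).
  by rewrite opprB !subrKA.
have := hnormD (l - y n) ((y n - T (y n)) - (T l - T (y n))).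
have := hnormB (y n - T (y n)) (T l - T (y n)); have := Tq l (y n).
have : q * hnorm (l - y n) <= hnorm (l - y n).
  by rewrite ler_piMl ?hnorm_ge0// ltW.
have := yS n; by lra.
Qed.

End Completeness.

(** * Bijectivity of the shifted operator *)

Section Resolvent.
Variables (R : realType) (k : scalar_kind).
Variables (V : completeNormedModType (scalar R k)).
Variable dot : {dot V for @scalar_conj R k}.
Hypothesis hV : norm_from_dot dot.
Variable A : {linear V -> V}.
Hypothesis (bndA : bounded_operator A) (accA : accretive dot A).
Local Notation sr := (@scalar_of_real R k).
Implicit Types (u v w x y z d : V) (b c g : R).

Lemma bounded_operator_ge0 :
  exists2 M : R, 0 <= M & forall v, hnorm (A v) <= M * hnorm v.
Proof.
have [M AM] := bndA; exists `|M| => // v; apply: le_trans (AM v) _.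
by rewrite ler_wpM2r ?hnorm_ge0// ler_norm.
Qed.

(** Solutions are fixed points of the damped iteration [v - t ((A + g) v - f)]. With [t = g / L^2],
    its linear part satisfies [|x - t (A + g) x|^2 <= (1 - t g) |x|^2 <= (1 - t g / 2)^2 |x|^2], a
    contraction factor free of square roots. *)
Lemma shift_surj g f : 0 < g -> exists v, shift A g v = f.
Proof.
move=> g0; have [M M0 AM] := bounded_operator_ge0.
pose L := M + g; have L0 : 0 < L by rewrite ltr_wpDl.
have BL v : hnorm (shift A g v) <= L * hnorm v.
  by rewrite mulrDl (le_trans (hnormD _ _))// hnormZ gtr0_norm// lerD2r.
pose t := g / L ^+ 2; have t0 : 0 < t by rewrite divr_gt0// exprn_gt0.
have tL : t * L ^+ 2 = g by rewrite mulfVK// sqrf_eq0 gt_eqF.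
have tg1 : t * g <= 1.
  rewrite /t mulrAC -expr2 ler_pdivrMr ?exprn_gt0// mul1r.
  by rewrite lerXn2r ?nnegrE ?(ltW g0) ?(ltW L0)// lerDr.
have tg0 : 0 < t * g by rewrite mulr_gt0.
pose T v := v - sr t *: (shift A g v - f).
have TB v w : T v - T w = (v - w) - sr t *: shift A g (v - w).
  rewrite /T shiftB opprD addrACA -opprD -scalerBr opprB.
  by rewrite subrKA.
have [||v w|v Tv] := @hnorm_contraction_fixpoint _ _ _ T (1 - t * g / 2).
- by lra.
- by lra.
- rewrite TB; move: (v - w) => x.
  have q0 : 0 <= 1 - t * g / 2 by lra.
  have gx : g * hnorm x ^+ 2 <= rdot dot (shift A g x) x.
    by rewrite /shift !rdotE (hnorm_sqr hV) lerDr accA.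
  have Lx : hnorm (shift A g x) ^+ 2 <= L ^+ 2 * hnorm x ^+ 2.
    by rewrite -exprMn lerXn2r ?nnegrE ?mulr_ge0 ?hnorm_ge0 ?(ltW L0).
  move: (shift A g x) gx Lx => y gx Lx.
  rewrite -(@ler_pXn2r _ 2)// ?nnegrE ?hnorm_ge0 ?mulr_ge0 ?hnorm_ge0//.
  rewrite (hnorm_sqr hV) !rdotE (rdotC dot x).
  rewrite -!(hnorm_sqr hV) exprMn.
  have := ler_wpM2l (ltW t0) gx.
  have := ler_wpM2l (ltW t0) (ler_wpM2l (ltW t0) Lx).
  rewrite (mulrA t (L ^+ 2)) tL => h1 h2.
  have := sqr_ge0 (t * g * hnorm x); rewrite !expr2 in h1 h2 * => h3.
  by lra.
- exists v; apply/eqP; rewrite -subr_eq0.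
  move/eqP: Tv; rewrite /T -subr_eq0 addrAC subrr add0r oppr_eq0 scaler_eq0.
  by rewrite -(scalar_of_real0 R k) (can_eq (@scalar_of_realK R k)) gt_eqF.
Qed.

Lemma shift_invK g f : 0 < g -> shift A g (shift_inv A g f) = f.
Proof.
move=> g0; rewrite /shift_inv pinvK// inE /=.
by have [v vf] := shift_surj f g0; exists v.
Qed.

Lemma u_reg_error u g : 0 < g ->
  shift A g (u_reg A u g - u) = - (sr g *: u).
Proof.
by move=> g0; rewrite shiftB shift_invK// /shift opprD addrA subrr add0r.
Qed.

End Resolvent.

Lemma small_factor (R : realType) (a b : R) :
  0 <= a -> 0 < b -> exists2 c, 0 < c & c * a <= b.
Proof.
move=> a0 b0; have a1 : 0 < a + 1 by rewrite ltr_wpDl.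
exists (b / (a + 1)); first by rewrite divr_gt0.
by rewrite mulrAC ler_pdivrMr// ler_pM2l// lerDl.
Qed.

(** * Noise that no parameter choice can compensate *)

Section LowerBound.
Variables (R : realType) (k : scalar_kind).
Variables (V : completeNormedModType (scalar R k)).
Variable dot : {dot V for @scalar_conj R k}.
Hypothesis hV : norm_from_dot dot.
Variable A : {linear V -> V}.
Hypothesis (bndA : bounded_operator A) (accA : accretive dot A).
Local Notation sr := (@scalar_of_real R k).
Implicit Types (u v w x y z d : V) (b c g : R).

(* An approximate kernel vector [d] of an accretive [A] is also one of the
   adjoint: expand [0 <= Re <A (d + t z), d + t z>] with [t] small. *)
Lemma accretive_approx_cokernel (r W kappa : R) :
  0 <= r -> 0 <= W -> 0 < kappa ->
  exists2 e : R, 0 < e & forall d z, hnorm d = r -> hnorm (A d) <= e * r ->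
    hnorm z <= W -> - rdot dot d (A z) <= kappa.
Proof.
move=> r0 W0 kappa0; have [M M0 AM] := bounded_operator_ge0 bndA.
have k2 : 0 < kappa / 2 by rewrite divr_gt0.
(* Dividing the expansion by [t] leaves [t <A z, z> + e r (W + r / t)]: first [t], then [e], makes
   each summand at most [kappa / 2]. *)
have [t t0 tk] := small_factor (mulr_ge0 M0 (sqr_ge0 W)) k2.
have a0 : 0 <= r * (W + r / t).
  by rewrite mulr_ge0// addr_ge0// divr_ge0// ltW.
have [e e0 ek] := small_factor a0 k2.
exists e => // d z dr Ad zW.
have z0 := hnorm_ge0 z.
have dz : 0 <= rdot dot (A (d + sr t *: z)) (d + sr t *: z) by exact: accA.
rewrite linearD linearZ_LR !rdotE (rdotC dot (A z) d) in dz.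
have Adz : rdot dot (A d) z <= e * r * W.
  apply: le_trans (rdot_le hV _ _) _.
  by apply: ler_pM => //; exact: hnorm_ge0.
have Add : rdot dot (A d) d <= e * r * r.
  apply: le_trans (rdot_le hV _ _) _; rewrite dr.
  by apply: ler_pM => //; exact: hnorm_ge0.
have Azz : rdot dot (A z) z <= M * W ^+ 2.
  apply: le_trans (rdot_le hV _ _) _.
  apply: (@le_trans _ _ (M * hnorm z * hnorm z)).
    by rewrite ler_wpM2r.
  by rewrite -mulrA -expr2 ler_wpM2l// lerXn2r ?nnegrE.
have tAzz : t * rdot dot (A z) z <= kappa / 2.
  by apply: le_trans tk; rewrite ler_pM2l.
have ekt : e * r * r <= t * (kappa / 2 - e * r * W).
  have -> : e * r * r = t * (e * (r * (W + r / t)) - e * r * W).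
    by field; rewrite gt_eqF.
  by rewrite ler_pM2l// lerD2r.
rewrite -(ler_pM2l t0).
have := ler_wpM2l (ltW t0) Adz; have := ler_wpM2l (ltW t0) tAzz.
by lra.
Qed.

Lemma exists_bad_noise u z g :
  (forall e : R, 0 < e -> exists2 v, v != 0 & hnorm (A v) <= e * hnorm v) ->
  0 < g -> shift A g z = sr g *: u -> 0 < hnorm z ->
  exists2 d, hnorm d = 4 * (g * hnorm z) &
    forall b y, 0 < b -> shift A b y = d - sr b *: u -> hnorm z / 4 <= hnorm y.
Proof.
move=> unb g0 zu z0; set e := hnorm z in z0 *.
pose r := 4 * (g * e); have r0 : 0 < r by rewrite !mulr_gt0.
(* The factor 3/8 leaves [e^2 - 2 (3/8) e^2 = (e / 2)^2] in the case [g < b]. *)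
have kappa0 : 0 < 3 / 8 * (g ^+ 2 * e ^+ 2).
  by rewrite !mulr_gt0// exprn_gt0.
have [eps1 eps10 coker] := accretive_approx_cokernel (ltW r0) (hnorm_ge0 u) kappa0.
(* [eps1] serves the approximate cokernel; [g / 16] makes [|A d| <= g^2 e / 4]. *)
pose eps := Num.min eps1 (g / 16).
have g16 : 0 < g / 16 by rewrite divr_gt0.
have eps0 : 0 < eps by rewrite lt_min eps10.
have [v v0 Av] := unb _ eps0; have vn0 := hnorm_gt0 v0.
(* Rescale [v] to norm [r] and flip its sign if needed. *)
have [d [dr Ad du]] : exists d, [/\ hnorm d = r, hnorm (A d) <= eps * r &
    rdot dot d u <= 0].
  pose s : R := (if rdot dot v u <= 0 then 1 else -1).
  have s1 : `|s| = 1 by rewrite /s; case: ifP => _; rewrite ?normrN normr1.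
  have sa : `|s * (r / hnorm v)| = r / hnorm v.
    by rewrite normrM s1 mul1r gtr0_norm ?divr_gt0.
  exists (sr (s * (r / hnorm v)) *: v); split.
  - by rewrite hnormZ sa divfK// gt_eqF.
  - rewrite linearZ_LR hnormZ sa mulrAC ler_pdivrMr// (mulrAC eps).
    by rewrite [leLHS]mulrC ler_pM2r.
  - rewrite rdotZl mulrAC pmulr_lle0 ?divr_gt0//.
    rewrite /s; case: ifPn => [|]; first by rewrite mul1r.
    by rewrite -ltNge mulN1r oppr_le0 => /ltW.
exists d => // b y b0 yE.
have [z' z'u] := shift_surj hV bndA accA (sr b *: u) b0.
have [y' y'd] := shift_surj hV bndA accA d b0.
(* Split into the noise contribution [y'] and the noise-free error [z' = u - u_b]. *)
have -> : y = y' - z'.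
  by apply: (shift_inj hV accA b0); rewrite yE shiftB y'd z'u.
have e4 : eps * r <= g * (g * e / 4).
  have : eps * r <= g / 16 * r by rewrite ler_pM2r// ge_min lexx orbT.
  by rewrite /r; lra.
(* For [b <= g], [|y'| >= |yg|] by monotonicity. Since [A d = (A + g) (d - g yg)], [g yg] is within
   [g e / 4] of [d], so [|yg| >= 2 e], while [|z'| <= e]. *)
have [bg|gb] := leP b g.
  have z'z : hnorm z' <= e by exact: shift_scaled_le b0 bg z'u zu.
  have [yg ygd] := shift_surj hV bndA accA d g0.
  have [yy' _] := shift_eq_le hV accA b0 bg (etrans y'd (esym ygd)).
  have dyg : hnorm (A d) >= g * hnorm (d - sr g *: yg).
    have := shift_ge hV accA g (d - sr g *: yg).
    by rewrite shiftB shiftZ ygd {1}/shift addrK.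
  have := ler_hnormB d (d - sr g *: yg).
  rewrite subKr (ge0_hnormZ _ (ltW g0)) dr => h.
  have dyg' : hnorm (d - sr g *: yg) <= g * e / 4.
    by rewrite -(ler_pM2l g0) (le_trans dyg)// (le_trans Ad).
  have gyg : g * (2 * e) <= g * hnorm yg.
    by move: h; rewrite /r; have := mulr_gt0 g0 z0; lra.
  rewrite ler_pM2l// in gyg.
  by have := ler_hnormB y' z'; lra.
(* For [g < b], [y'] is [d / b] up to an error [e / 4], and [|d / b - z'| >= e / 2]. *)
have b2 : 0 < b^-1 by rewrite invr_gt0.
have ezz' : e <= hnorm z' by exact: shift_scaled_le (ltW gb) zu z'u.
have z'W : hnorm z' <= hnorm u.
  have := shift_ge hV accA b z'.
  by rewrite z'u ge0_hnormZ ?(ltW b0)// ler_pM2l.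
have y'E : y' = sr b^-1 *: d - sr b^-1 *: A y'.
  by rewrite -y'd /shift -scalerBr addrAC subrr add0r scalerA -scalar_of_realM
    mulVf ?gt_eqF// scalar_of_real1 scale1r.
have z'E : z' = u - sr b^-1 *: A z'.
  apply: (can_inj (scalerK (a := sr b) _)).
    by rewrite -(scalar_of_real0 R k) (can_eq (@scalar_of_realK R k)) gt_eqF.
  by rewrite scalerBr -z'u scalerA -scalar_of_realM divff ?gt_eqF//
    scalar_of_real1 scale1r /shift addrAC subrr add0r.
(* [A] commutes with [A + b], so [A y'] solves the shifted equation for [A d], giving
   [b |A y'| <= |A d|]. *)
have Ay' : hnorm (sr b^-1 *: A y') <= e / 4.
  have bA : b * hnorm (A y') <= eps * r.
    have AA : shift A b (A y') = A d by rewrite -y'd /shift linearD linearZ_LR.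
    by apply: le_trans Ad; rewrite -AA; exact: (shift_ge hV accA).
  rewrite (ge0_hnormZ _ (ltW b2)) mulrC ler_pdivrMr// -(ler_pM2l b0).
  apply: le_trans bA (le_trans e4 _).
  rewrite -mulrA (mulrC (_ / 4)); apply: ler_pM.
  - exact: ltW.
  - by rewrite mulr_ge0// ?ltW// divr_gt0.
  - exact: ltW.
  - by rewrite ler_pM2r ?divr_gt0// ltW.
have dz' : rdot dot (sr b^-1 *: d) z' <= 3 / 8 * e ^+ 2.
  have c := coker d z' dr _ z'W.
  have {c} : - rdot dot d (A z') <= 3 / 8 * (g ^+ 2 * e ^+ 2).
    apply: c; apply: le_trans Ad _.
    by rewrite ler_pM2r// ge_min lexx.
  have g2b : 3 / 8 * (g ^+ 2 * e ^+ 2) <= b ^+ 2 * (3 / 8 * e ^+ 2).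
    have : g ^+ 2 * e ^+ 2 <= b ^+ 2 * e ^+ 2.
      by rewrite ler_pM2r ?exprn_gt0// lerXn2r ?nnegrE ?(ltW g0) ?(ltW b0) ?(ltW gb).
    by lra.
  move=> /le_trans/(_ g2b) c.
  (* Insert [z' = u - A z' / b] and discard [<d, u> <= 0]. *)
  have bdz : b * rdot dot d z' <= - rdot dot d (A z').
    rewrite {1}z'E !rdotE mulrDr mulrN mulVKf ?gt_eqF//.
    by rewrite gerDr pmulr_rle0.
  rewrite rdotZl -(ler_pM2l b0) mulVKf ?gt_eqF// -(ler_pM2l b0).
  by apply: le_trans bdz _; rewrite mulrA -expr2.
have h : e / 2 <= hnorm (sr b^-1 *: d - z').
  have e2 : 0 <= e / 2 by rewrite divr_ge0// ltW.
  rewrite -(@ler_pXn2r _ 2)// ?nnegrE ?hnorm_ge0// (hnorm_sqr hV).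
  move: dz'; move: (sr b^-1 *: d) => x dz'.
  rewrite !rdotE -!(hnorm_sqr hV) (rdotC dot z').
  have := sqr_ge0 (hnorm x).
  have : e ^+ 2 <= hnorm z' ^+ 2 by rewrite lerXn2r ?nnegrE ?hnorm_ge0 ?(ltW z0).
  by rewrite exprMn; lra.
have -> : y' - z' = (sr b^-1 *: d - z') - sr b^-1 *: A y'.
  by rewrite {1}y'E addrAC.
have := ler_hnormB (sr b^-1 *: d - z') (sr b^-1 *: A y').
by lra.
Qed.
End LowerBound.

(** * From bad noise to the decay rate *)

Section Converse.
Variables (R : realType) (k : scalar_kind).
Variables (V : completeNormedModType (scalar R k)).
Variable dot : {dot V for @scalar_conj R k}.
Hypothesis hV : norm_from_dot dot.
Variable A : {linear V -> V}.
Hypothesis (bndA : bounded_operator A) (accA : accretive dot A).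
Local Notation sr := (@scalar_of_real R k).

(** In the expanded square, the cross term [2 g Re <A v, v>] is nonnegative. *)
Lemma shift_ge_op (g : R) (v : V) : 0 <= g -> hnorm (A v) <= hnorm (shift A g v).
Proof.
move=> g0; rewrite -(@ler_pXn2r _ 2)// ?nnegrE ?hnorm_ge0// !(hnorm_sqr hV).
rewrite /shift !rdotE (rdotC dot v (A v)) -!(hnorm_sqr hV).
have := mulr_ge0 g0 (accA v); rewrite -/(rdot dot _ _).
by have := mulr_ge0 g0 (mulr_ge0 g0 (sqr_ge0 (hnorm v))); lra.
Qed.

(** The single datum [A u + d] is a competitor in the supremum; its errors solve the displayed
    equation. *)
Lemma max_best_error_ge (u : V) (c delta : R) (d : V) : hnorm d <= delta ->
  (forall g y, 0 < g -> shift A g y = d - sr g *: u -> c <= hnorm y) ->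
  (c%:E <= max_best_error A u delta)%E.
Proof.
move=> d_delta hc; apply: (@le_trans _ _ (ereal_inf
  [set (hnorm (shift_inv A g (A u + d) - u))%:E | g in [set g : R | 0 < g]])).
  apply: le_ereal_inf_tmp => _ [g /= g0 <-]; rewrite lee_fin; apply: (hc g) => //.
  rewrite shiftB (shift_invK hV bndA accA)// /shift opprD addrA.
  by rewrite (addrC (A u)) addrK.
apply: ereal_sup_ubound; exists (A u + d) => //=.
by rewrite opprD addrA subrr add0r hnormN.
Qed.

End Converse.

(** Raise to the power [p + 1], so that the right side carries [E^p], and cancel that positive
    factor. *)
Lemma powR_self_bound (R : realType) (p C E g : R) : 0 < p -> 0 < C -> 0 < E ->
  0 < g -> E / 4 <= C * (4 * (g * E)) `^ (p / (p + 1)) ->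
  E <= (4 * C) `^ (p + 1) * 4 `^ p * g `^ p.
Proof.
move=> p0 C0 E0 g0 hE; have p1 : 0 < p + 1 by rewrite addr_gt0.
have {}hE : E <= 4 * C * (4 * (g * E)) `^ (p / (p + 1)) by move: hE; lra.
have C4 : 0 <= 4 * C by rewrite mulr_ge0 ?(ltW C0).
have gE : 0 <= g * E by rewrite mulr_ge0 ?(ltW g0) ?(ltW E0).
have rhs0 : 0 <= 4 * C * (4 * (g * E)) `^ (p / (p + 1)).
  by rewrite mulr_ge0 ?powR_ge0.
have := ge0_ler_powR (ltW p1) (ltW E0) rhs0 hE.
rewrite (powRM _ C4) ?powR_ge0// -powRrM divfK ?gt_eqF// (powRM _ _ gE)//.
rewrite (powRM _ (ltW g0) (ltW E0)) powRD; last by rewrite (gt_eqF E0) implybT.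
by rewrite powRr1 ?(ltW E0)// mulrC !mulrA ler_pM2r// powR_gt0.
Qed.

Theorem theorem4p5 (R : realType) (k : scalar_kind)
  (V : completeNormedModType (scalar R k))
  (dot : {dot V for @scalar_conj R k}) (hV : norm_from_dot dot)
  (A : {linear V -> V}) (hbounded : bounded_operator A)
  (haccretive : accretive dot A) (u : V)
  (p : R) (hp0 : 0 < p) (hp1 : p <= 1)
  (hP : ereal_bigO 0^'+ (max_best_error A u)
          (fun delta : R => delta `^ (p / (p + 1)))) :
  (fun gamma : R => hnorm (u_reg A u gamma - u))
    =O_ (0^'+) (fun gamma : R => gamma `^ p).
Proof.
apply/eqO_exP.
have zE g : 0 < g -> shift A g (u - u_reg A u g) = scalar_of_real k g *: u.
  by move=> g0; rewrite -opprB shiftN (u_reg_error hV hbounded haccretive)// opprK.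
have [unb|] := pselect
    (forall e : R, 0 < e -> exists2 v, v != 0 & hnorm (A v) <= e * hnorm v); last first.
  move=> /existsNP[e /not_implyP[e0 /forall2NP Ae]].
  have below v : e * hnorm v <= hnorm (A v).
    have [->|v0] := eqVneq v 0; first by rewrite hnorm0 mulr0 hnorm_ge0.
    by case: (Ae v) => [|/negP]; [rewrite v0|rewrite -ltNge => /ltW].
  (* If [A] is bounded below by [e], the error is at most [g |u| / e]; the summand 1 keeps the
     constant positive when [u = 0]. *)
  exists (hnorm u / e + 1); first by rewrite ltr_wpDl// divr_ge0 ?hnorm_ge0// ltW.
  near=> g.
  have g0 : 0 < g by [].
  have g1 : g <= 1 by near: g; exact: nbhs_right_le.
  rewrite ger0_norm ?hnorm_ge0// ger0_norm ?powR_ge0// -hnormN opprB.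
  have := le_trans (below _) (shift_ge_op hV haccretive (u - u_reg A u g) (ltW g0)).
  rewrite zE// (ge0_hnormZ _ (ltW g0)) mulrC -ler_pdivlMr// => /le_trans; apply.
  (* This uses both [g <= 1] and [p <= 1]. *)
  have gp : g <= g `^ p by rewrite -{1}(powRr1 (ltW g0)) ger_powR// g0.
  rewrite -mulrA mulrC; apply: ler_pM => //.
  - by rewrite divr_ge0 ?hnorm_ge0// ltW.
  - by rewrite lerDl.
have [C C0 [d0 /= d00 Pd]] := hP.
exists ((4 * C) `^ (p + 1) * 4 `^ p).
  by rewrite mulr_gt0 ?powR_gt0// mulr_gt0.
near=> g.
have g0 : 0 < g by [].
rewrite ger0_norm ?hnorm_ge0// ger0_norm ?powR_ge0// -hnormN opprB.
have := zE _ g0; set z := u - _ => zu.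
(* A zero error would give noise level 0, so it is settled separately. *)
have [z0|z0] := leP (hnorm z) 0.
  by rewrite (le_trans z0)// !mulr_ge0 ?powR_ge0.
have [d dr hd] := exists_bad_noise hV hbounded haccretive unb g0 zu z0.
have dr' : hnorm d <= 4 * (g * hnorm z) by rewrite dr.
have dP := max_best_error_ge hV hbounded haccretive dr' hd.
apply: powR_self_bound => //.
(* This bound, uniform in [g], forces [4 g |z| < d0] for small [g], so the hypothesis applies at
   that noise level. *)
have zu' : hnorm z <= hnorm u.
  have := shift_ge hV haccretive g z.
  by rewrite zu (ge0_hnormZ _ (ltW g0)) ler_pM2l.
have delta0 : 0 < 4 * (g * hnorm z) by rewrite !mulr_gt0.
have := Pd (4 * (g * hnorm z)) _ delta0.
rewrite /= sub0r normrN gtr0_norm// (ger0_norm (powR_ge0 _ _)) => P.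
rewrite -lee_fin (le_trans dP)// (le_trans (lee_abs _))// P//.
have gd : g < d0 / (4 * (hnorm u + 1)).
  by near: g; apply: nbhs_right_lt; rewrite divr_gt0// mulr_gt0// ltr_wpDl// hnorm_ge0.
rewrite ltr_pdivlMr in gd; last by rewrite mulr_gt0// ltr_wpDl// hnorm_ge0.
apply: le_lt_trans gd; rewrite mulrCA ler_pM2l// ler_pM2l//.
by rewrite (le_trans zu')// lerDl.
Unshelve. all: by end_near.
Qed.
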